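(* Let $p\ge1$, $X\in\Omega^p(V)$ and $H\in\mathscr H^p(V)$. Then $$X\boxplus H=X\iff H=\mathbb 1(\lfloor p\rfloor),$$ where $\mathbb 1(\lfloor p\rfloor)$ denotes the functional on $\triangle_J$ that is constantly equal to the unit $(1,0,\dots,0)\in T^{(\lfloor p\rfloor)}(V)$.
   Context: Setting. $J=[S,T]$ is a fixed compact interval and $\triangle_J=\{(s,t)\in J^2: s\le t\}$. $V$ is a Banach space; $V^{\otimes n}$ ($V^{\otimes 0}=\mathbb R$) denotes its completed tensor powers with admissible norms: permutations in $S_n$ act by isometries on $V^{\otimes n}$, and $\|v\otimes w\|\le\|v\|\|w\|$. $T^{(k)}(V)=\bigoplus_{i=0}^kV^{\otimes i}$ with product $(a\otimes b)^i=\sum_{j=0}^i a^j\otimes b^{i-j}$; $a^i$ is the level-$i$ component. A control on $J$ is a continuous $\omega:\triangle_J\to[0,\infty)$ with $\omega(t,t)=0$ and $\omega(s,u)+\omega(u,t)\le\omega(s,t)$ for $s\le u\le t$. Put $x!:=\Gamma(x+1)$, $\beta(p)=p\bigl(1+\sum_{r=3}^\infty(\frac{2}{r-2})^{(\lfloor p\rfloor+1)/p}\bigr)$. A map $X:\triangle_J\to T^{(k)}(V)$ has finite $p$-variation controlled by $\omega$ with constant $K$ if $\|X^i_{s,t}\|\le K\,\omega(s,t)^{i/p}/(\beta(p)(i/p)!)$ for $i=1,\dots,k$, $(s,t)\in\triangle_J$. A multiplicative functional of degree $k$ is a continuous $X:\triangle_J\to T^{(k)}(V)$ with $X^0\equiv1$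 and $X_{s,u}\otimes X_{u,t}=X_{s,t}$ for $s\le u\le t$. $\Omega^{(k,p)}(V)$: those of finite $p$-variation for some control and constant; $\Omega^p(V):=\Omega^{(\lfloor p\rfloor,p)}(V)$ ($p$-rough paths). Sewing. For $\theta>1$, $\Omega^{\mathrm{am},(k,p)}_{\theta,\omega}(V)$ is the set of maps $X=(1,X^1,\dots,X^k):\triangle_J\to T^{(k)}(V)$ that for some $K\ge0$ have finite $p$-variation controlled by $\omega$ with constant $K$ and satisfy $\|(X_{s,u}\otimes X_{u,t}-X_{s,t})^i\|\le K\omega(s,t)^\theta$ for $s\le u\le t$, $i=1,\dots,k$. By Lyons' rough sewing lemma, for such $X$ there is a unique multiplicative functional $\bar X$ of degree $k$ with finite $p$-variation such that $\|\bar X^i_{s,t}-X^i_{s,t}\|\le C\omega(s,t)^\theta$ for some $C$ and all $(s,t)$, $i=1,\dots,k$; it is independent of the witnessing $(p,\theta,\omega)$ and denoted $\mathscr S^k(X)$. $\mathscr H^p(V)$ is the set of $H\in\Omega^p(V)$ for which there are a control $\omega$, $\phi\in(1-\frac1p,1]$ and $K\ge0$ with $\|H^j_{s,t}\|\le K\omega(s,t)^\phi$ for $j=1,\dots,\lfloor p\rfloor$, $(s,t)\in\triangle_J$. For $X\in\Omega^p(V)$, $H\in\mathscr H^p(V)$ let $(X\oplus H)_{s,t}:=(1,X^1_{s,t}+H^1_{s,t},\dots,X^{\lfloor p\rfloor}_{s,t}+H^{\lfloor p\rfloor}_{s,t})$; this lies in some $\Omega^{\mathrm{am},(\lfloor p\rfloor,p)}_{\theta,\omega}(V)$,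 and $X\boxplus H:=\mathscr S^{\lfloor p\rfloor}(X\oplus H)\in\Omega^p(V)$. *)

(* Defs.v *)
From HB Require Import structures.
From mathcomp Require Import all_boot all_order all_algebra all_fingroup.
From mathcomp Require Import all_classical all_reals all_analysis.

Set Implicit Arguments.
Unset Strict Implicit.
Unset Printing Implicit Defensive.

Import Order.TTheory GRing.Theory Num.Theory.
Import numFieldNormedType.Exports.

Local Open Scope classical_set_scope.
Local Open Scope ring_scope.

Section Tensor_powers.
Variable R : realType.

Definition tuple_set (T : Type) n (u : n.-tuple T) (i : 'I_n) (x : T) :
  n.-tuple T := [tuple if j == i then x else tnth u j | j < n].

Definition multilinear (V W : lmodType R) n (f : n.-tuple V -> W) : Prop :=
  forall (u : n.-tuple V) (i : 'I_n), linear (fun x : V => f (tuple_set u i x)).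

(* A choice of completed tensor powers of V with admissible norms.  By
   [pure_multilinear], [pure_universal] and [pure_dense], the linear span of the
   pure tensors v_1 (x) ... (x) v_n in the Banach space [tpow n] is an algebraic
   n-th tensor power of V, and [tpow n] is its completion.  The only degrees of
   freedom left are the norms.  [tpow 0] and [tpow 1] are R and V up to the
   isometries a |-> a *: pure [tuple] and v |-> pure [tuple v]. *)
Record tensor_powers (V : completeNormedModType R) := TensorPowers {
  tpow : nat -> completeNormedModType R ;
  pure : forall n, n.-tuple V -> tpow n ;
  pure_multilinear : forall n, multilinear (@pure n) ;
  (* every multilinear map factors through a linear map on the span of the pure
     tensors; outside that span the values of g are irrelevant *)
  pure_universal : forall n (W : lmodType R) (f : n.-tuple V -> W),
    multilinear f ->
    exists g : tpow n -> W, forall m (c : 'I_m -> R) (u : 'I_m -> n.-tuple V),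
      g (\sum_(l < m) c l *: pure (u l)) = \sum_(l < m) c l *: f (u l) ;
  pure_dense : forall n, dense [set x : tpow n |
    exists m (c : 'I_m -> R) (u : 'I_m -> n.-tuple V),
      x = \sum_(l < m) c l *: pure (u l)] ;
  tprod : forall m n, {bilinear tpow m -> tpow n -> tpow (m + n)%N} ;
  tprod_pure : forall m n (u : m.-tuple V) (v : n.-tuple V),
    tprod m n (pure u) (pure v) = pure [tuple of u ++ v] ;
  norm_tprod : forall m n (a : tpow m) (b : tpow n),
    `|tprod m n a b| <= `|a| * `|b| ;
  perm_isometry : forall n (s : 'S_n), exists2 g : {linear tpow n -> tpow n},
    (forall u : n.-tuple V, g (pure u) = pure [tuple tnth u (s l) | l < n]) &
    (forall x, `|g x| = `|x|) ;
  norm_pure0 : `|pure [tuple]| = 1 ;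
  norm_pure1 : forall v : V, `|pure [tuple v]| = `|v|
}.

End Tensor_powers.

Section Truncated_tensor_algebra.
Variables (R : realType) (V : completeNormedModType R) (E : tensor_powers V).

(* T^(k)(V), an element being the family of its levels 0, ..., k *)
Definition trunc_tensor (k : nat) : Type := forall i : 'I_k.+1, tpow E i.

Definition tprod_to m n i (e : (m + n)%N = i) (a : tpow E m) (b : tpow E n) :
  tpow E i := ecast l (tpow E l) e (tprod E m n a b).

Definition tmul k (a b : trunc_tensor k) : trunc_tensor k := fun i =>
  \sum_(j < i.+1)
    tprod_to (subnKC (leq_ord j))
      (a (widen_ord (ltn_ord i) j)) (b (widen_ord (ltn_ord i) (sub_ord j))).

Definition level_one (n : nat) : tpow E n :=
  match n with 0 => pure E [tuple] | _.+1 => 0 end.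

Definition tone k : trunc_tensor k := fun i => level_one i.

End Truncated_tensor_algebra.
Arguments tone {R V} E k i.

Section Real_constants.
Variable R : realType.

(* x! = Gamma(x + 1) *)
Definition real_fact (x : R) : R :=
  Rintegral (@lebesgue_measure R) `]0, +oo[ (fun t => t `^ x * expR (- t)).

Definition beta_const (p : R) : R :=
  p * (1 + limn (fun n : nat => \sum_(3 <= r < n)
    (2 / (r%:R - 2)) `^ ((Num.truncn p).+1%:R / p))).

End Real_constants.

Section Rough_paths.
Variables (R : realType) (V : completeNormedModType R) (E : tensor_powers V).

(* Functions on the triangle are total functions on R * R whose values outside
   of the triangle are never used; equality is equality on the triangle. *)
Definition triangle (S T : R) : set (R * R) :=
  [set st | S <= st.1 /\ st.1 <= st.2 /\ st.2 <= T].

Definition control (S T : R) (w : R * R -> R) : Prop :=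
  [/\ {within triangle S T, continuous w},
      forall st, triangle S T st -> 0 <= w st,
      forall t, S <= t <= T -> w (t, t) = 0 &
      forall s u t, S <= s -> s <= u -> u <= t -> t <= T ->
        w (s, u) + w (u, t) <= w (s, t)].

Definition finite_pvar (S T : R) k (p : R) (w : R * R -> R) (K : R)
    (X : R * R -> trunc_tensor E k) : Prop :=
  forall st, triangle S T st -> forall i : 'I_k.+1, (0 < i)%N ->
    `|X st i| <= K * w st `^ (i%:R / p) / (beta_const p * real_fact (i%:R / p)).

(* Continuity into the finite direct sum T^(k)(V) is continuity of each level. *)
Definition mult_functional (S T : R) k (X : R * R -> trunc_tensor E k) : Prop :=
  [/\ forall i : 'I_k.+1, {within triangle S T, continuous (fun st => X st i)},
      forall st, triangle S T st -> X st ord0 = pure E [tuple] &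
      forall s u t, S <= s -> s <= u -> u <= t -> t <= T ->
        tmul (X (s, u)) (X (u, t)) = X (s, t)].

(* Omega^(k,p)(V) *)
Definition mult_functional_pvar (S T : R) k (p : R)
    (X : R * R -> trunc_tensor E k) : Prop :=
  mult_functional S T X /\
  exists w K, [/\ control S T w, 0 <= K & finite_pvar S T p w K X].

(* Omega^p(V) *)
Definition rough_path (S T p : R)
    (X : R * R -> trunc_tensor E (Num.truncn p)) : Prop :=
  mult_functional_pvar S T p X.

(* Omega^{am,(k,p)}_{theta,w}(V) *)
Definition almost_mult (S T : R) k (p theta : R) (w : R * R -> R)
    (X : R * R -> trunc_tensor E k) : Prop :=
  (forall st, triangle S T st -> X st ord0 = pure E [tuple]) /\
  exists K, [/\ 0 <= K, finite_pvar S T p w K X &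
    forall s u t, S <= s -> s <= u -> u <= t -> t <= T ->
      forall i : 'I_k.+1, (0 < i)%N ->
        `|tmul (X (s, u)) (X (u, t)) i - X (s, t) i| <= K * w (s, t) `^ theta].

Definition is_sewing (S T : R) k (X Y : R * R -> trunc_tensor E k) : Prop :=
  exists p theta w,
    [/\ [/\ 1 <= p, 1 < theta & control S T w],
        almost_mult S T p theta w X,
        mult_functional_pvar S T p Y &
        exists C, forall st, triangle S T st -> forall i : 'I_k.+1, (0 < i)%N ->
          `|Y st i - X st i| <= C * w st `^ theta].

(* The sewing map, by description: by Lyons' rough sewing lemma, an almost
   multiplicative X has exactly one sewing on the triangle, which does not
   depend on p, theta and w.  The default value, for an X without a sewing, is
   the zero map, which is not a multiplicative functional. *)
Definition sewing (S T : R) k (X : R * R -> trunc_tensor E k) :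
    R * R -> trunc_tensor E k :=
  xget ((fun _ _ => 0) : {classic R * R -> trunc_tensor E k})
    [set Y | is_sewing S T X Y].

(* H^p(V) *)
Definition perturbation (S T p : R)
    (H : R * R -> trunc_tensor E (Num.truncn p)) : Prop :=
  rough_path S T H /\
  exists w phi K, [/\ control S T w, 1 - p^-1 < phi <= 1, 0 <= K &
    forall st, triangle S T st ->
      forall j : 'I_(Num.truncn p).+1, (0 < j)%N -> `|H st j| <= K * w st `^ phi].

Definition level_oplus (n : nat) : tpow E n -> tpow E n -> tpow E n :=
  match n with 0 => fun _ _ => pure E [tuple] | _.+1 => fun a b => a + b end.

Definition oplus k (X H : R * R -> trunc_tensor E k) : R * R -> trunc_tensor E k :=
  fun st i => level_oplus (X st i) (H st i).

Definition boxplus (S T : R) k (X H : R * R -> trunc_tensor E k) :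
  R * R -> trunc_tensor E k := sewing S T (oplus X H).

End Rough_paths.

(* Main.v *)
Require Import Defs.
From HB Require Import structures.
From mathcomp Require Import all_boot all_order all_algebra all_fingroup.
From mathcomp Require Import all_classical all_reals all_analysis.
From mathcomp Require Import lra.

Set Implicit Arguments.
Unset Strict Implicit.
Unset Printing Implicit Defensive.

Import Order.TTheory GRing.Theory Num.Theory.
Import numFieldNormedType.Exports.

Local Open Scope classical_set_scope.
Local Open Scope ring_scope.

(** Both implications reduce to one rigidity statement: two multiplicative
    functionals which differ, on every level, by at most a constant times
    [w `^ theta] with [w] a control and [theta > 1] coincide
    ([mult_functional_close_eq]).

    If [boxplus S T X H = X], then [boxplus S T X H] has unit level 0 and is
    therefore a genuine sewing ([sewing_is_sewing]); its defining bound reads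
    [|X^i - (X^i + H^i)| <= C * w `^ theta]: the functional [H] lies within
    [C * w `^ theta] of the unit functional.  Both are multiplicative, so they are
    equal.

    Conversely, if [H] is the unit functional, [oplus X H] is [X] on the
    triangle; it is multiplicative, so [X] is one of its sewings
    ([mult_functional_is_sewing]).  The sewing selected by [boxplus] lies within
    [C * w `^ theta] of [X] too, so it equals [X].

    Rigidity is proved level by level.  If the lower levels agree, the Chen
    identity bounds the difference on [(s, t)] by the sum of the differences on
    [(s, u)] and [(u, t)], as only the two extreme terms of the level-[i] product
    survive ([norm_tmulB]).  On short intervals the bound [C * w `^ theta] is at
    most [eps * w], because controls are uniformly small near the diagonal; by
    superadditivity of [w] this linear bound passes from short to long intervals,
    and [eps] is arbitrary ([subadditive_control_powR_le0]). *)

(** * Controls and subadditive functions *)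

(** Continuity of the control and its vanishing on the diagonal give smallness
    near each point of the diagonal; compactness of [[S, T]] makes it uniform. *)
Lemma control_small_near_diagonal (R : realType) (S T : R) (w : R * R -> R)
    (eta : R) :
  control S T w -> 0 < eta ->
  exists2 delta, 0 < delta & forall s t, S <= s -> s <= t -> t <= T ->
    t - s < delta -> w (s, t) <= eta.
Proof.
move=> [/subspace_continuousP w_cont _ w_diag _] eta0.
have : \forall d \near 0^'+, `[S, T] `<=`
    [set s | forall t, S <= s -> s <= t -> t <= T -> t - s < d ->
      w (s, t) <= eta].
  apply: (compact_near_coveringP _).1; first exact: segment_compact.
  move=> x; rewrite /= in_itv/= => /andP[Sx xT].
  have tri : triangle S T (x, x) by rewrite /triangle/=.
  have wx0 : w (x, x) = 0 by apply: w_diag; rewrite Sx.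
  have /cvgrPdist_lt/(_ _ eta0) := w_cont _ tri.
  rewrite near_withinE => /nbhs_ballP[r /= r0 br].
  have r20 : 0 < r / 2 by rewrite divr_gt0.
  exists (ball x (r / 2), [set d | d < r / 2]).
    by split => /=; [exact: nbhsx_ballx | exact: nbhs_right_lt].
  move=> [s d]/= [xs dr] t Ss st tT tsd.
  have /br/(_ _) : ball (x, x) r (s, t).
    move: xs; rewrite /ball/= !ltr_distlC => /andP[xs sx].
    by split; rewrite /ball/= ltr_distlC; apply/andP; split; lra.
  rewrite /from_subspace wx0 sub0r normrN => wst.
  by apply: ltW; apply: le_lt_trans (ler_norm _) _; apply: wst; split.
rewrite nearE => /nbhs_ballP[e /= e0 be].
have e20 : 0 < e / 2 by rewrite divr_gt0.
exists (e / 2) => // s t Ss st tT ts.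
apply: (be (e / 2)) => //=; last by rewrite in_itv/= Ss (le_trans st).
by rewrite /ball/= sub0r normrN gtr0_norm//; lra.
Qed.

(** For every [eps > 0] the bound [f <= eps * w] holds on short intervals, where
    [C * w `^ (theta - 1) <= eps].  Bisection extends it to all intervals, since
    [f] is subadditive and [w] superadditive. *)
Lemma subadditive_control_powR_le0 (R : realType) (S T C theta : R)
    (w f : R * R -> R) :
  control S T w -> 1 < theta ->
  (forall s u t, S <= s -> s <= u -> u <= t -> t <= T ->
    f (s, t) <= f (s, u) + f (u, t)) ->
  (forall st, triangle S T st -> f st <= C * w st `^ theta) ->
  forall st, triangle S T st -> f st <= 0.
Proof.
move=> w_ctl theta1 f_sub f_le.
have [_ w_ge0 _ w_super] := w_ctl.
have f_small eps : 0 < eps -> forall st, triangle S T st -> f st <= eps * w st.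
  move=> eps0.
  have C0 : 0 < `|C| + 1 by rewrite ltr_wpDl.
  have theta0 : 0 < theta - 1 by rewrite subr_gt0.
  (* The solution of (|C| + 1) * eta `^ (theta - 1) = eps; the sign of C is
     unknown. *)
  pose eta := (eps / (`|C| + 1)) `^ (theta - 1)^-1.
  have eta0 : 0 < eta by rewrite powR_gt0// divr_gt0.
  have etaE : eta `^ (theta - 1) = eps / (`|C| + 1).
    by rewrite -powRrM mulVf ?powRr1// ?gt_eqF// divr_ge0// ltW.
  have [d d0 w_small] := control_small_near_diagonal w_ctl eta0.
  have f_short s t : S <= s -> s <= t -> t <= T -> t - s < d ->
      f (s, t) <= eps * w (s, t).
    move=> Ss st tT ts; have tri : triangle S T (s, t) by split.
    have w0 := w_ge0 _ tri.
    apply: (le_trans (f_le _ tri)).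
    rewrite -(mulr_powRB1 w0 (lt_trans ltr01 theta1)) mulrCA mulrC.
    apply: ler_wpM2r => //.
    apply: (@le_trans _ _ ((`|C| + 1) * w (s, t) `^ (theta - 1))).
      by rewrite ler_wpM2r ?powR_ge0// (le_trans (ler_norm _))// lerDl.
    rewrite mulrC -ler_pdivlMr//.
    rewrite -etaE; apply: ge0_ler_powR; rewrite ?nnegrE ?(ltW eta0) ?(ltW theta0)//.
    exact: w_small.
  have f_dyadic n s t : S <= s -> s <= t -> t <= T -> t - s < d * 2 ^+ n ->
      f (s, t) <= eps * w (s, t).
    elim: n s t => [|n IHn] s t Ss st tT; first by rewrite mulr1; exact: f_short.
    rewrite exprS => ts; pose u := (s + t) / 2.
    have su : s <= u by rewrite /u; lra.
    have ut : u <= t by rewrite /u; lra.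
    apply: (le_trans (f_sub _ _ _ Ss su ut tT)).
    apply: (@le_trans _ _ (eps * (w (s, u) + w (u, t)))); last first.
      by apply: ler_wpM2l; [exact: ltW | exact: w_super].
    rewrite mulrDr; apply: lerD.
      by apply: IHn; rewrite ?(le_trans ut)// /u; lra.
    by apply: IHn; rewrite ?(le_trans Ss)// /u; lra.
  move=> [s t] [/= Ss [st tT]].
  have [n nP] : exists n, (t - s) / d < n%:R.
    exists (Num.truncn ((t - s) / d)).+1; exact: truncnS_gt.
  apply: (f_dyadic n) => //; rewrite mulrC -ltr_pdivrMr// (lt_trans nP)//.
  by rewrite -natrX ltr_nat ltn_expl.
move=> st tri; apply/ler_addgt0Pl => e e0; rewrite addr0.
have w0 := w_ge0 _ tri.
have w1 : 0 < w st + 1 by rewrite ltr_wpDl.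
apply: (le_trans (f_small (e / (w st + 1)) (divr_gt0 e0 w1) _ tri)).
by rewrite mulrAC ler_pdivrMr// ler_wpM2l ?ltW// ltrDl.
Qed.

(** * The truncated tensor product *)

Section Tensor_products.
Variables (R : realType) (V : completeNormedModType R) (E : tensor_powers V).

Lemma tprod_toBl m n i (e : (m + n)%N = i) (a a' : tpow E m) (b : tpow E n) :
  tprod_to e (a - a') b = tprod_to e a b - tprod_to e a' b.
Proof. by case: i / e; rewrite /= linearBl. Qed.

Lemma tprod_toBr m n i (e : (m + n)%N = i) (a : tpow E m) (b b' : tpow E n) :
  tprod_to e a (b - b') = tprod_to e a b - tprod_to e a b'.
Proof. by case: i / e; rewrite /= linearBr. Qed.

Lemma norm_tprod_to m n i (e : (m + n)%N = i) (a : tpow E m) (b : tpow E n) :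
  `|tprod_to e a b| <= `|a| * `|b|.
Proof. by case: i / e; exact: norm_tprod. Qed.

Lemma tprod_to0l m n i (e : (m + n)%N = i) (b : tpow E n) :
  tprod_to e (0 : tpow E m) b = 0.
Proof. by case: i / e; rewrite /= linear0l. Qed.

Lemma tprod_to0r m n i (e : (m + n)%N = i) (a : tpow E m) :
  tprod_to e a (0 : tpow E n) = 0.
Proof. by case: i / e; rewrite /= linear0r. Qed.

(** On level [i], all terms of the two products involving only lower levels cancel
    and the extreme ones carry a factor [pure E [tuple]] of norm one.  The
    estimate avoids identifying [tpow E 0 (x) tpow E i] with [tpow E i]. *)
Lemma norm_tmulB k (a b a' b' : trunc_tensor E k) (i : 'I_k.+1) :
  a' ord0 = pure E [tuple] -> b ord0 = pure E [tuple] ->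
  (forall j : 'I_k.+1, (j < i)%N -> a j = a' j /\ b j = b' j) ->
  `|tmul a b i - tmul a' b' i| <= `|a i - a' i| + `|b i - b' i|.
Proof.
move=> a'0 b0 low; rewrite /tmul -sumrB.
(* The two factors of the extreme terms sit at levels i and 0. *)
have iw : widen_ord (ltn_ord i) ord_max = i by exact: ord_inj.
have is0 : widen_ord (ltn_ord i) (sub_ord (@ord0 i)) = i.
  by apply/val_inj; rewrite /= subn0.
have i0 : widen_ord (ltn_ord i) ord0 = ord0 by exact: ord_inj.
have isi : widen_ord (ltn_ord i) (sub_ord (@ord_max i)) = ord0.
  by apply/val_inj; rewrite /= subnn.
pose wd := widen_ord (ltn_ord i).
pose F (j : 'I_i.+1) := `|a (wd j) - a' (wd j)| * `|b (wd (sub_ord j))|.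
pose G (j : 'I_i.+1) := `|a' (wd j)| *
  `|b (wd (sub_ord j)) - b' (wd (sub_ord j))|.
(* Norm bounds for the two halves of the telescoping
   a (x) b - a' (x) b' = (a - a') (x) b + a' (x) (b - b'). *)
apply: (@le_trans _ _ (\sum_j (F j + G j))).
  apply: (le_trans (ler_norm_sum _ _ _)); apply: ler_sum => j _.
  rewrite -(subrKA (tprod_to (subnKC (leq_ord j)) (a' (wd j))
    (b (wd (sub_ord j))))) -tprod_toBl -tprod_toBr.
  apply: (le_trans (ler_normD _ _)); apply: lerD; exact: norm_tprod_to.
rewrite big_split/=; apply: lerD.
- rewrite (bigD1 ord_max)//= big1 ?addr0 => [|j jm].
    by rewrite /F /wd iw isi b0 norm_pure0 mulr1.
  have ji : (wd j < i)%N by rewrite /= ltn_neqAle jm -ltnS ltn_ord.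
  by rewrite /F (low _ ji).1 subrr normr0 mul0r.
- rewrite (bigD1 ord0)//= big1 ?addr0 => [|j jm].
    by rewrite /G /wd i0 is0 a'0 norm_pure0 mul1r.
  have ji : (wd (sub_ord j) < i)%N.
    have j0 : (0 < j)%N by rewrite lt0n.
    by rewrite /= ltn_subrL j0 (leq_trans j0)// -ltnS ltn_ord.
  by rewrite /G (low _ ji).2 subrr normr0 mulr0.
Qed.

Lemma tone_pos k (i : 'I_k.+1) : (0 < i)%N -> tone E k i = 0.
Proof. by case: i => -[]. Qed.

Lemma tmul_tone k : tmul (tone E k) (tone E k) = tone E k.
Proof.
apply: functional_extensionality_dep => i; rewrite /tmul.
have [i_pos|] := ltnP 0 i.
  rewrite tone_pos// big1// => j _.
  have [j_pos|] := ltnP 0 j; first by rewrite tone_pos// tprod_to0l.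
  rewrite leqn0 => /eqP j0; rewrite (@tone_pos _ (widen_ord _ (sub_ord j))).
    by rewrite tprod_to0r.
  by rewrite /= j0 subn0.
rewrite leqn0 => /eqP i0; have {i0} -> : i = ord0 by exact: ord_inj.
rewrite big_ord_recl big_ord0 addr0 /tone/=.
move: (subnKC _) => /= e; rewrite /tprod_to (eq_irrelevance e (erefl 0%N))/=.
rewrite tprod_pure; congr pure; exact: tuple0.
Qed.

End Tensor_products.

(** * Uniqueness of sewings *)

Section Sewing.
Variables (R : realType) (V : completeNormedModType R) (E : tensor_powers V).
Variables (S T : R).

(** This is the uniqueness half of the sewing lemma.  Once [X] and [Y] agree below
    level [i], the Chen identity and [norm_tmulB] make [|Y^i - X^i|] subadditive,
    and a subadditive function of order [w `^ theta] with [theta > 1] vanishes. *)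
Lemma mult_functional_close_eq k (X Y : R * R -> trunc_tensor E k)
    (C theta : R) (w : R * R -> R) :
  control S T w -> 1 < theta -> mult_functional S T X -> mult_functional S T Y ->
  (forall st, triangle S T st -> forall i : 'I_k.+1, (0 < i)%N ->
    `|Y st i - X st i| <= C * w st `^ theta) ->
  forall st, triangle S T st -> Y st = X st.
Proof.
move=> w_ctl theta1 [_ X0 X_mul] [_ Y0 Y_mul] YX_le.
suff level_eq n (i : 'I_k.+1) : nat_of_ord i = n ->
    forall st, triangle S T st -> Y st i = X st i.
  move=> st tri; apply: functional_extensionality_dep => i.
  exact: (level_eq i).
elim/ltn_ind: n i => n IHn i i_n st tri.
have [i_pos|] := ltnP 0 i; last first.
  rewrite leqn0 => /eqP i0; have -> : i = ord0 by exact: val_inj.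
  by rewrite X0 ?Y0.
apply/eqP; rewrite -subr_eq0 -normr_le0.
apply: (subadditive_control_powR_le0 (f := fun st => `|Y st i - X st i|)
  w_ctl theta1 _ _ tri); last by move=> ? tri'; exact: YX_le.
move=> s u t Ss su ut tT.
have tri_su : triangle S T (s, u) by split => //; split => //; exact: le_trans tT.
have tri_ut : triangle S T (u, t) by split => //; exact: le_trans su.
rewrite -(X_mul _ _ _ Ss su ut tT) -(Y_mul _ _ _ Ss su ut tT); apply: norm_tmulB;
  [exact: X0 | exact: Y0 |].
by move=> j ji; split; apply: (IHn j) => //; rewrite -i_n.
Qed.

Lemma mult_functional_tone k : mult_functional S T (fun=> tone E k).
Proof.
split=> // [i|s u t _ _ _ _]; last exact: tmul_tone.
by move=> x; exact: cvg_cst.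
Qed.

(** A multiplicative functional is its own sewing, with any exponent and with
    defect zero; [Z] allows for arbitrary values outside the triangle. *)
Lemma mult_functional_is_sewing k p (X Z : R * R -> trunc_tensor E k) :
  1 <= p -> mult_functional_pvar S T p X ->
  (forall st, triangle S T st -> Z st = X st) -> is_sewing S T Z X.
Proof.
move=> p1 X_mfp ZX; have [[_ X0 X_mul] [w [K [w_ctl K0 X_le]]]] := X_mfp.
exists p, 2, w; split=> //; first by split=> //; rewrite ltr1n.
- split; first by move=> st tri; rewrite ZX// X0.
  exists K; split=> //; first by move=> st tri i i_pos; rewrite ZX//; exact: X_le.
  move=> s u t Ss su ut tT i _.
  have tri_su : triangle S T (s, u).
    by split => //; split => //; exact: le_trans tT.
  have tri_ut : triangle S T (u, t) by split => //; exact: le_trans su.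
  have tri_st : triangle S T (s, t) by split => //; split => //; exact: le_trans ut.
  by rewrite !ZX// X_mul// subrr normr0 mulr_ge0// powR_ge0.
- by exists 0 => st tri i i_pos; rewrite ZX// subrr normr0 mul0r.
Qed.

(** A functional with unit level 0 at a single point is not the default value of
    [sewing], since [pure E [tuple]] has norm one; hence it is a genuine
    sewing. *)
Lemma sewing_is_sewing k (X : R * R -> trunc_tensor E k) st :
  sewing S T X st ord0 = pure E [tuple] -> is_sewing S T X (sewing S T X).
Proof.
rewrite /sewing; case: xgetP => [Y _ //|_ /eqP].
by rewrite eq_sym -normr_eq0 norm_pure0 oner_eq0.
Qed.

Lemma oplus_pos k (X H : R * R -> trunc_tensor E k) st (i : 'I_k.+1) :
  (0 < i)%N -> oplus X H st i = X st i + H st i.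
Proof. by rewrite /oplus; case: i => -[]. Qed.

Lemma oplus_tone k (X H : R * R -> trunc_tensor E k) st :
  X st ord0 = pure E [tuple] -> H st = tone E k -> oplus X H st = X st.
Proof.
move=> X0 H1; apply: functional_extensionality_dep => i.
have [i_pos|] := ltnP 0 i; first by rewrite oplus_pos// H1 tone_pos// addr0.
by rewrite leqn0 => /eqP i0; have -> : i = ord0 by exact: val_inj.
Qed.

End Sewing.

(** * Trivial perturbations *)

Theorem corollary6p3 (R : realType) (V : completeNormedModType R)
    (E : tensor_powers V) (S T p : R)
    (X H : R * R -> trunc_tensor E (Num.truncn p)) :
  S <= T -> 1 <= p -> rough_path S T X -> perturbation S T H ->
  (forall st, triangle S T st -> boxplus S T X H st = X st) <->
  (forall st, triangle S T st -> H st = tone E (Num.truncn p)).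
Proof.
move=> ST p1 X_rough [[H_mf _] _]; have [X_mf _] := X_rough.
have [_ X0 _] := X_mf.
split=> [XH|H1] st tri.
- have tri_S : triangle S T (S, S) by split.
  have XH0 : sewing S T (oplus X H) (S, S) ord0 = pure E [tuple].
    by rewrite -/(boxplus S T X H) XH// X0.
  have [q [theta [w [[_ theta1 w_ctl] _ _ [C XH_le]]]]] := sewing_is_sewing XH0.
  apply: (mult_functional_close_eq w_ctl theta1 (mult_functional_tone _ _ _ _)
    H_mf (C := C) _ tri) => {st tri} st tri i i_pos.
  have := XH_le _ tri _ i_pos.
  by rewrite -/(boxplus S T X H) XH// oplus_pos// opprD addNKr normrN tone_pos//
    subr0.
- have oplusX st' : triangle S T st' -> oplus X H st' = X st'.
    by move=> tri'; rewrite oplus_tone ?X0 ?H1.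
  have X_sew := mult_functional_is_sewing p1 X_rough oplusX.
  have [q [theta [w [[_ theta1 w_ctl] _ [Y_mf _] [C YX_le]]]]] :
    is_sewing S T (oplus X H) (boxplus S T X H) by exact: (xgetI _ X_sew).
  apply: (mult_functional_close_eq w_ctl theta1 X_mf Y_mf (C := C) _ tri).
  by move=> st' tri' i i_pos; rewrite -oplusX//; exact: YX_le.
Qed.
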